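(* For each integer $k\ge 1$, there is a crossing tournament such that every numbering of it has clique number at least $k$. Consequently its chromatic number is at least $k$.
   Context: All tournaments are finite. The chromatic number of a tournament $T$ is the minimum $k$ such that $V(T)$ is the union of $k$ sets each inducing an acyclic (transitive) subtournament. Given a numbering $v_1,\ldots,v_n$ of the vertex set of a tournament $T$, the backedge graph is the (undirected) graph with vertex set $V(T)$ in which, for $1\le i<j\le n$, $v_i$ and $v_j$ are adjacent if and only if the edge of $T$ between them is directed from $v_j$ to $v_i$. The clique number of a numbering of a tournament is the size of the largest clique in the corresponding backedge graph. An integer matching is a finite set $P$ of pairs $(a,b)$ of integers with $a<b$, such that all the integers used in pairs of $P$ are distinct. The crossing tournament defined by an integer matching $P$ is the tournament with vertex set $P$ in which, for distinct $(a,b),(c,d)\in P$, the edge is directed from $(a,b)$ to $(c,d)$ if either $a<b<c<d$, or $c<a<b<d$, or $c<a<d<b$ (in other words, if when $a,b,c,d$ are arranged in increasing order, the second term is one of $a,b$). A crossing tournament is a tournament arising in this way. *)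

(* Defs.v *)
From mathcomp Require Import all_boot all_order all_algebra finmap.
From mathcomp Require Import zify.

Set Implicit Arguments.
Unset Strict Implicit.
Unset Printing Implicit Defensive.

Import Order.TTheory GRing.Theory Num.Theory.

Record tournament : Type := Tournament {
  vertex :> finType;
  edge : rel vertex;
  edge_irr : irreflexive edge;
  edge_tour : forall x y : vertex, x != y -> edge x y (+) edge y x }.

Section TournamentInvariants.

Variable T : tournament.

(* A numbering of [T] is a bijection [v : 'I_#|T| -> T]. *)
Definition backedge (v : 'I_#|T| -> T) : rel T := fun x y =>
  [exists i : 'I_#|T|, exists j : 'I_#|T|,
     [&& i < j, edge (v j) (v i) & [set x; y] == [set v i; v j]]].

Definition clique (g : rel T) (K : {set T}) : bool :=
  [forall x in K, forall y in K, (x != y) ==> g x y].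

Definition clique_number (v : 'I_#|T| -> T) : nat :=
  \max_(K : {set T} | clique (backedge v) K) #|K|.

Definition induced (X : {set T}) : rel T := fun x y =>
  [&& x \in X, y \in X & edge x y].

(* No edge of the subtournament induced by [X] closes up to a directed cycle
   inside [X]; see [acyclicP]. *)
Definition acyclic (X : {set T}) : bool :=
  [forall x, forall y, induced X x y ==> ~~ connect (induced X) y x].

Lemma acyclicP (X : {set T}) :
  reflect (forall s : seq T, s != [::] -> {subset s <= X} -> ~~ cycle (@edge T) s)
          (acyclic X).
Proof.
rewrite /acyclic; set eX := induced X.
have path_eX y (r : seq T) : y \in X -> {subset r <= X} ->
    path (@edge T) y r = path eX y r.
  elim: r y => //= z r IHr y yX rX.
  have zX : z \in X by apply: rX; rewrite mem_head.
  rewrite IHr // => [|t rt]; last by apply: rX; rewrite inE rt orbT.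
  by rewrite /eX /induced yX zX.
have sub_eX (s : seq T) : {subset s <= X} -> cycle (@edge T) s = cycle eX s.
  case: s => [|x s] //= sX; apply: path_eX; first by apply: sX; rewrite mem_head.
  by move=> y; rewrite mem_rcons; apply: sX.
apply: (iffP forallP) => [acX s s_n0 sX|acX x].
  rewrite sub_eX //; case: s s_n0 {sX} => [|x s] //= _.
  case: s => [|y s] /=.
    by rewrite /eX /induced edge_irr !andbF.
  apply/negP => /andP[exy pys].
  move: (forallP (acX x) y); rewrite exy /= => /negP; apply.
  by apply/connectP; exists (rcons s x) => //; rewrite last_rcons.
apply/forallP => y; apply/implyP => exy; apply/negP => /connectP[p pth_p def_x].
have cyc : cycle eX (y :: p) by rewrite /= rcons_path pth_p -def_x.
have subX : {subset y :: p <= X}.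
  move=> z; rewrite inE => /predU1P[->|]; first by case/and3P: exy.
  elim: p {def_x cyc exy} y pth_p => [|w p IHp] y //= /andP[/and3P[_ wX _] pw].
  by rewrite inE => /predU1P[->|/(IHp w pw)].
by move/negP: (acX (y :: p) isT subX); rewrite sub_eX.
Qed.

Definition colorable (k : nat) : bool :=
  [exists F : {ffun 'I_k -> {set T}},
     (\bigcup_(i < k) F i == [set: T]) && [forall i, acyclic (F i)]].

Lemma ex_colorable : exists k, colorable k.
Proof.
exists #|T|; apply/existsP; exists [ffun i => [set enum_val i]].
apply/andP; split.
  apply/eqP/setP => x; rewrite inE; apply/bigcupP.
  by exists (enum_rank x); rewrite // ffunE enum_rankK inE.
apply/forallP => i; rewrite ffunE.
apply/forallP => x; apply/forallP => y; apply/implyP.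
by rewrite /induced !inE => /and3P[/eqP-> /eqP->]; rewrite edge_irr.
Qed.

Definition chromatic_number : nat := ex_minn ex_colorable.

End TournamentInvariants.

Record int_matching : Type := IntMatching {
  pairs :> {fset int * int};
  pairs_lt : forall p, p \in pairs -> (p.1 < p.2)%R;
  pairs_uniq : uniq (flatten [seq [:: p.1; p.2] | p <- enum_fset pairs]) }.

Definition crossing_edge (p q : int * int) : bool :=
  let: (a, b) := p in let: (c, d) := q in
  ([|| [&& a < b, b < c & c < d],
       [&& c < a, a < b & b < d]
     | [&& c < a, a < d & d < b]])%R.

Section CrossingTournament.

Variable P : int_matching.

Definition crossing_rel : rel P := fun p q => crossing_edge (val p) (val q).

Lemma crossing_irr : irreflexive crossing_rel.
Proof. by case=> [[a b] abP]; rewrite /crossing_rel /=; lia. Qed.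

Lemma pairs_disjoint (p q : int * int) :
  p \in pairs P -> q \in pairs P -> p != q ->
  [/\ p.1 != q.1, p.1 != q.2, p.2 != q.1 & p.2 != q.2].
Proof.
move=> pP qP; have := pairs_uniq P.
have {pP}: p \in enum_fset P by [].
have {qP}: q \in enum_fset P by [].
elim: (enum_fset P) => [|r s IHs] //=.
rewrite !inE => qs ps /and3P[r1 r2 us].
have mem t i : t \in s -> i \in [:: t.1; t.2] ->
    i \in flatten [seq [:: u.1; u.2] | u <- s].
  by move=> ts it; apply/flatten_mapP; exists t.
have nr t : t \in s -> [/\ r.1 != t.1, r.1 != t.2, r.2 != t.1 & r.2 != t.2].
  move=> ts; move: r1 r2; rewrite negb_or => /andP[_ r1] r2.
  by split; [apply: contraNneq r1 => ->|apply: contraNneq r1 => ->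
            |apply: contraNneq r2 => ->|apply: contraNneq r2 => ->];
     apply: (mem t) => //; rewrite !inE eqxx ?orbT.
case/predU1P: ps => [->|ps]; case/predU1P: qs => [->|qs] npq.
- by rewrite eqxx in npq.
- exact: nr.
- by have [] := nr _ ps; split; rewrite eq_sym.
- exact: IHs.
Qed.

Lemma crossing_tour (p q : P) :
  p != q -> crossing_rel p q (+) crossing_rel q p.
Proof.
move=> npq; have := pairs_disjoint (valP p) (valP q) npq.
have := pairs_lt (valP p); have := pairs_lt (valP q).
rewrite /crossing_rel; case: (val p) (val q) => [a b] [c d] /=.
by move=> lt_cd lt_ab [ac ad bc bd]; lia.
Qed.

Definition crossing_tournament : tournament :=
  Tournament crossing_irr crossing_tour.

End CrossingTournament.

(* Main.v *)
Require Import Defs.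
From mathcomp Require Import all_order all_algebra finmap zify.
From mathcomp Require Import all_boot.

(** Given a numbering with position function pos, a set of vertices is a clique
    of the backedge graph iff its edges all go against pos.  Take intervals
    (i, j), one for each i < j < N, and apply Ramsey's theorem to 4-subsets of
    {0, .., N-1}, coloured by how pos compares the two disjoint, respectively
    crossing, intervals they carry.  If pos never increases along disjoint
    intervals, many disjoint intervals form a clique.  Otherwise pos always
    increases along disjoint intervals; if it also increases along crossing ones,
    many pairwise crossing intervals form a clique.  The remaining case is
    impossible: it gives pos(4,6) <= pos(2,5) <= pos(1,3) < pos(4,6).
    For the chromatic number, number the vertices by nondecreasing in-degree
    within their class of an optimal colouring.  In-degree strictly increases
    along the edges of a transitive tournament, so the backedge graph is properly
    coloured and its cliques have at most one vertex per class. *)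

Set Implicit Arguments.
Unset Strict Implicit.
Unset Printing Implicit Defensive.

Import Order.TTheory.

(** * Ramsey's theorem for two-coloured subsequences of fixed length *)

Section Ramsey.

Variable A : eqType.

Definition homogeneous (f : seq A -> bool) (r : nat) (b : bool) (s : seq A) :=
  forall t, subseq t s -> size t = r -> f t = b.

Lemma homogeneous_sub f r b s t :
  subseq t s -> homogeneous f r b s -> homogeneous f r b t.
Proof. by move=> ts hs u ut; apply: hs; apply: subseq_trans ts. Qed.

(* The colour of an [r.+1]-subsequence is determined by its first entry. *)
Fixpoint end_homogeneous (f : seq A -> bool) (r : nat) (s : seq A) : Prop :=
  if s is x :: s' then
    (exists b, homogeneous (fun t => f (x :: t)) r b s') /\
    end_homogeneous f r s'
  else True.

Lemma homogeneous_cons f r b x s :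
  homogeneous (fun t => f (x :: t)) r b s -> homogeneous f r.+1 b s ->
  homogeneous f r.+1 b (x :: s).
Proof.
move=> hx hs [|y t] //=; case: eqP => [->|_] ts => [[]|] szt; first exact: hx.
exact: hs.
Qed.

(** Each entry joins [s0] or [s1] according to the colour of the subsequences it starts. *)
Lemma end_homogeneous_split f r s : end_homogeneous f r s ->
  exists s0 s1, [/\ subseq s0 s, subseq s1 s, size s <= size s0 + size s1,
    homogeneous f r.+1 false s0 & homogeneous f r.+1 true s1].
Proof.
elim: s => [_|x s IHs /= [[b hx] /IHs [s0 [s1 [sub0 sub1 szs h0 h1]]]]].
  by exists [::], [::]; split=> // t; rewrite subseq0 => /eqP->.
case: b hx => hx.
  exists s0, (x :: s1); split; rewrite /= ?eqxx ?addnS //.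
    exact: subseq_trans (subseq_cons _ _).
  by apply: homogeneous_cons => //; apply: homogeneous_sub hx.
exists (x :: s0), s1; split; rewrite /= ?eqxx ?addSn //.
  exact: subseq_trans (subseq_cons _ _).
by apply: homogeneous_cons => //; apply: homogeneous_sub hx.
Qed.

(** Induction on [r]: keep the head [x], use the case [r] to thin the tail until [f (x :: t)] is
    constant over [t] of size [r], and repeat. After [m.*2] rounds, at least [m] of the kept entries
    share a colour. *)
Lemma ramsey (r m : nat) : exists N, forall (f : seq A -> bool) (l : seq A),
  N <= size l ->
  exists s b, [/\ subseq s l, m <= size s & homogeneous f r b s].
Proof.
elim: r m => [|r IHr] m.
  exists m => f l szl; exists l, (f [::]); split=> // t _.
  by move/size0nil->.
have [N hN] : exists N, forall (f : seq A -> bool) (l : seq A), N <= size l ->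
    exists s, [/\ subseq s l, m.*2 <= size s & end_homogeneous f r s].
  elim: m.*2 => [|n [N hN]].
    by exists 0 => f l _; exists [::]; rewrite sub0seq.
  have [M hM] := IHr N; exists M.+1 => f [|x l] //=.
  rewrite ltnS => /(hM (fun t => f (x :: t))) [s [b [sl szs hs]]].
  have [t [ts szt ht]] := hN f s szs.
  exists (x :: t); split; rewrite /= ?eqxx ?(subseq_trans ts) //.
  by split=> //; exists b; apply: homogeneous_sub hs.
exists N => f l /(hN f) [s [sl szs]].
move=> /end_homogeneous_split [s0 [s1 [sub0 sub1 szs01 h0 h1]]].
have [le_m|lt_m] := leqP m (size s0).
  by exists s0, false; rewrite (subseq_trans sub0).
by exists s1, true; split=> //; [apply: subseq_trans sl | lia].
Qed.

End Ramsey.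

(** * Ramsey's theorem applied to positions of intervals *)

Lemma subseq_map_nth (E : eqType) (x0 : E) (s : seq E) (t : seq nat) :
  sorted ltn t -> all (gtn (size s)) t -> subseq [seq nth x0 s i | i <- t] s.
Proof.
(* A strictly increasing list of indices is a filter of [iota]. *)
move=> t_sorted /allP t_lt; rewrite -[X in subseq _ X](mkseq_nth x0).
apply: map_subseq; suff -> : t = filter [in t] (iota 0 (size s)).
  exact: filter_subseq.
apply: (irr_sorted_eq ltn_trans ltnn) => // [|i].
  exact: sorted_filter ltn_trans _ _ (iota_ltn_sorted _ _).
by rewrite mem_filter mem_iota andb_idr // => /t_lt.
Qed.

Lemma subseq_nth4 (s : seq nat) (i j p q : nat) :
  i < j -> j < p -> p < q -> q < size s ->
  subseq [:: nth 0 s i; nth 0 s j; nth 0 s p; nth 0 s q] s.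
Proof.
by move=> ij jp pq qs; apply: (@subseq_map_nth _ 0 s [:: i; j; p; q]) => /=; lia.
Qed.

Lemma ramsey_pairs (n : nat) : exists N, forall pos : nat -> nat -> nat,
  exists s : seq nat, [/\ subseq s (iota 0 N), n <= size s &
    (forall a b c d, subseq [:: a; b; c; d] s -> pos c d <= pos a b) \/
    (forall a b c d, subseq [:: a; c; b; d] s -> pos a b < pos c d)].
Proof.
(* The summand 6 leaves room for the final contradiction even when [n] is small. *)
have [M hM] := @ramsey nat 4 (n + 6).
have [N hN] := @ramsey nat 4 M.
exists N => pos.
pose disj t := pos (nth 0 t 0) (nth 0 t 1) < pos (nth 0 t 2) (nth 0 t 3).
pose cross t := pos (nth 0 t 0) (nth 0 t 2) < pos (nth 0 t 1) (nth 0 t 3).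
have [|s [b [sN szs hs]]] := hN disj (iota 0 N); first by rewrite size_iota.
have /= [u [b' [us szu hu]]] := hM cross s szs.
exists u; split; [exact: subseq_trans sN | lia |].
have{} hs := homogeneous_sub us hs.
case: b hs => hs; last first.
  by left=> a b c d tu; have := hs _ tu erefl; rewrite /disj /=; lia.
case: b' hu => hu; first by right=> a b c d tu; apply: (hu _ tu).
have u6 i : i < 6 -> i < size u by lia.
(* The intervals (1,3), (2,5), (4,6) on six consecutive elements of [u]. *)
have := hu _ (subseq_nth4 (isT : 0 < 1) (isT : 1 < 2) (isT : 2 < 4) (u6 4 isT)) erefl.
have := hu _ (subseq_nth4 (isT : 1 < 3) (isT : 3 < 4) (isT : 4 < 5) (u6 5 isT)) erefl.
have := hs _ (subseq_nth4 (isT : 0 < 2) (isT : 2 < 3) (isT : 3 < 5) (u6 5 isT)) erefl.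
by rewrite /disj /cross /=; lia.
Qed.

(** * Cliques of backedge graphs and the chromatic number *)

Section Numberings.

Variable T : tournament.

Lemma backedge_sym (v : 'I_#|T| -> T) : symmetric (backedge v).
Proof. by move=> x y; rewrite /backedge setUC. Qed.

Lemma backedgeP (v : 'I_#|T| -> T) (x y : T) :
  reflect (exists i j : 'I_#|T|, [/\ i < j, edge (v j) (v i) &
             (x = v i /\ y = v j) \/ (x = v j /\ y = v i)])
          (backedge v x y).
Proof.
apply: (iffP existsP) => [[i /existsP[j /and3P[ij e /eqP E]]]|].
  exists i, j; split=> //.
  have vij : v i != v j by apply: contraTneq e => ->; rewrite edge_irr.
  have /set2P xE : x \in [set v i; v j] by rewrite -E set21.
  have /set2P yE : y \in [set v i; v j] by rewrite -E set22.
  have /set2P iE : v i \in [set x; y] by rewrite E set21.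
  have /set2P jE : v j \in [set x; y] by rewrite E set22.
  move: vij; case: xE iE jE => -> iE jE; case: yE iE jE => -> iE jE.
  - by case: jE => ->; rewrite eqxx.
  - by left.
  - by right.
  - by case: iE => ->; rewrite eqxx.
move=> [i [j [ij e E]]]; exists i; apply/existsP; exists j; rewrite ij e /=.
by case: E => -[-> ->]; rewrite // setUC.
Qed.

Lemma backedge_irr (v : 'I_#|T| -> T) : irreflexive (backedge v).
Proof.
move=> x; apply/backedgeP => -[i [j [_ e E]]].
have vij : v i = v j by case: E => -[<- <-].
by rewrite vij edge_irr in e.
Qed.

Lemma leq_clique_number (v : 'I_#|T| -> T) (k : nat) (f : 'I_k -> T) :
  (forall i j : 'I_k, i < j -> backedge v (f i) (f j)) -> k <= clique_number v.
Proof.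
move=> fP.
have fN (i j : 'I_k) : i != j -> backedge v (f i) (f j).
  by rewrite -val_eqE neq_ltn => /orP[/fP//|/fP]; rewrite backedge_sym.
have f_inj : injective f.
  move=> i j fij; apply/eqP/negPn/negP => /fN.
  by rewrite fij backedge_irr.
have <- : #|f @: [set: 'I_k]| = k by rewrite card_imset // cardsT card_ord.
apply: leq_bigmax_cond; apply/forall_inP => _ /imsetP[i _ ->].
apply/forall_inP => _ /imsetP[j _ ->]; apply/implyP => nij; apply: fN.
by apply: contraNneq nij => ->.
Qed.

(** An edge from [z] to [x] would close a triangle, and [x = z] a cycle of length two. *)
Lemma acyclic_edge_trans (X : {set T}) : acyclic X ->
  {in X & &, transitive (@edge T)}.
Proof.
move=> /acyclicP acX y x z yX xX zX xy yz.
have sX : {subset [:: x; y; z] <= X} by move=> t; rewrite !inE => /or3P[]/eqP->.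
have := acX [:: x; y; z] isT sX; rewrite /= xy yz /= andbT => zx.
have xz : x != z.
  apply: contraTneq yz => <-; apply/negP => yx.
  have sX' : {subset [:: x; y] <= X} by move=> t; rewrite !inE => /orP[]/eqP->.
  by have := acX [:: x; y] isT sX'; rewrite /= xy yx.
by have := edge_tour xz; rewrite (negPf zx) addbF.
Qed.

(** By transitivity, in-neighbours of [x] in [X] are in-neighbours of [y], and [x] itself is a
    further one. *)
Lemma acyclic_card_in (X : {set T}) (x y : T) : acyclic X ->
  x \in X -> y \in X -> edge x y ->
  #|[set z in X | edge z x]| < #|[set z in X | edge z y]|.
Proof.
move=> acX xX yX xy; apply: proper_card; apply/properP; split.
  apply/subsetP => z; rewrite !inE => /andP[zX zx].
  by rewrite zX (acyclic_edge_trans acX _ _ _ zx xy).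
by exists x; rewrite !inE xX ?xy ?edge_irr.
Qed.

Lemma numbering_of_rank (r : T -> nat) : exists v : 'I_#|T| -> T,
  bijective v /\ forall i j : 'I_#|T|, i < j -> r (v i) <= r (v j).
Proof.
pose s := sort (relpre r leq) (enum T).
have szs : size s = #|T| by rewrite size_sort cardE.
have us : uniq s by rewrite sort_uniq enum_uniq.
have ss : sorted (relpre r leq) s.
  by apply: sort_sorted => x y /=; apply: leq_total.
case: (posnP #|T|) => [T0|T0].
  (* An empty tournament has no default element for [nth]; its numbering is the empty map. *)
  have F (i : 'I_#|T|) : False by move: i; rewrite T0 => -[].
  exists (fun i => match F i with end); split=> [|i]; last by case: (F i).
  apply: inj_card_bij; last by rewrite card_ord.
  by move=> i; case: (F i).
have [x0 _] := card_gt0P T0.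
exists (fun i : 'I__ => nth x0 s i); split=> [|i j ij].
  apply: inj_card_bij; last by rewrite card_ord.
  by move=> i j /eqP; rewrite nth_uniq ?szs // => /eqP/val_inj.
have tr : transitive (relpre r leq) by move=> y x z /=; apply: leq_trans.
by apply: (sorted_ltn_nth tr x0 ss); rewrite ?inE ?szs.
Qed.

Lemma clique_number_chromatic : exists v : 'I_#|T| -> T,
  bijective v /\ clique_number v <= chromatic_number T.
Proof.
rewrite /chromatic_number.
case: ex_minnP => m /existsP[F /andP[/eqP FT /forallP acF]] _.
(* The classes [F i] may overlap, so one is chosen for each vertex. *)
have cov (x : T) : {i | x \in F i}.
  apply: sigW; have : x \in \bigcup_(i < m) F i by rewrite FT inE.
  by case/bigcupP => i _; exists i.
pose c x := sval (cov x); have cP x : x \in F (c x) := svalP (cov x).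
pose d x := #|[set z in F (c x) | edge z x]|.
have [v [v_bij v_le]] := numbering_of_rank d.
exists v; split=> //.
have back_c x y : backedge v x y -> c x != c y.
  case/backedgeP => i [j [ij e E]].
  suff ne : c (v i) != c (v j) by case: E => -[-> ->] //; rewrite eq_sym.
  apply/eqP => Ec; have := v_le i j ij; rewrite /d Ec leqNgt => /negP.
  by apply; apply: acyclic_card_in e => //; rewrite -Ec.
apply/bigmax_leqP => K /forall_inP clK.
rewrite -[m]card_ord -(@card_in_imset _ _ c K) ?max_card // => x y xK yK Exy.
apply/eqP/negPn/negP => nxy.
have /forall_inP/(_ y yK) := clK x xK; rewrite nxy => /back_c.
by rewrite Exy eqxx.
Qed.

End Numberings.

(** * The crossing tournament of all intervals [(i, j)] with [i < j < N] *)

Section ShiftMatching.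

Variable N : nat.

Definition slot (i j : nat) : int := Posz (i * N + j).

(* Pairs sharing the element [i] get distinct endpoints inside the block
   [i * N, ..., i * N + N - 1], so endpoints of distinct integers keep their order. *)
Definition shift_pair (i j : nat) : int * int := (slot i j, slot j i).

Lemma slot_lt (i i' j j' : nat) : j < N -> i < i' -> (slot i j < slot i' j')%R.
Proof. rewrite /slot => jN ii; suff : i * N + j < i' * N + j' by lia. nia. Qed.

Lemma slot_inj (i i' j j' : nat) : j < N -> j' < N ->
  slot i j = slot i' j' -> i = i' /\ j = j'.
Proof.
move=> jN j'N E; case: (ltngtP i i') => [lt|lt|Ei].
- by have := slot_lt j' jN lt; rewrite E ltxx.
- by have := slot_lt j j'N lt; rewrite E ltxx.
- by split=> //; move: E; rewrite /slot Ei; lia.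
Qed.

Definition shift_pairs : {fset int * int} :=
  [fset shift_pair (val p.1) (val p.2)
     | p in [pred p : 'I_N * 'I_N | val p.1 < val p.2]]%fset.

Lemma shift_pairsP p : reflect
  (exists i j, [/\ i < j, j < N & p = shift_pair i j]) (p \in shift_pairs).
Proof.
apply: (iffP (imfsetP _ _ _ _)) => [[[i j] /= ij ->]|[i [j [ij jN ->]]]].
  by exists i, j.
by exists (Ordinal (ltn_trans ij jN), Ordinal jN).
Qed.

Lemma shift_pairs_lt p : p \in shift_pairs -> (p.1 < p.2)%R.
Proof.
by case/shift_pairsP => i [j [ij jN ->]]; apply: slot_lt.
Qed.

Lemma shift_pairs_uniq :
  uniq (flatten [seq [:: p.1; p.2] | p <- enum_fset shift_pairs]).
Proof.
have sub p : p \in enum_fset shift_pairs -> p \in shift_pairs by [].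
have := fset_uniq shift_pairs.
elim: (enum_fset _) sub => //= p s IHs sub /andP[ps us].
have pP := sub p (mem_head _ _).
have {}sub q : q \in s -> q \in shift_pairs.
  by move=> qs; apply: sub; rewrite inE qs orbT.
have notin z : z \in [:: p.1; p.2] ->
    z \notin flatten [seq [:: q.1; q.2] | q <- s].
  move=> zp; apply/negP => /flatten_mapP[q qs zq].
  suff E : p = q by rewrite E qs in ps.
  case/shift_pairsP: pP zp => i [j [ij jN ->]].
  case/shift_pairsP: (sub q qs) zq => i' [j' [ij' jN' ->]].
  have iN := ltn_trans ij jN; have iN' := ltn_trans ij' jN'.
  (* A slot determines both indices; a left end equal to a right end would give [i < j] and
     [j < i]. *)
  rewrite !inE => /orP[]/eqP-> /orP[]/eqP/slot_inj[]// E1 E2; last by rewrite E1 E2.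
  - by rewrite E1 E2.
  - by lia.
  - by lia.
rewrite inE negb_or !notin ?inE ?eqxx ?orbT // andbT IHs // andbT.
by rewrite lt_eqF // shift_pairs_lt.
Qed.

Definition shift_matching := IntMatching shift_pairs_lt shift_pairs_uniq.
Definition shift_tournament := crossing_tournament shift_matching.

Lemma shift_vertices (k : nat) (l r : 'I_k -> nat) :
  (forall i, l i < r i < N) ->
  exists f : 'I_k -> shift_tournament,
    forall i, val (f i) = shift_pair (l i) (r i).
Proof.
move=> lrN; apply: (fin_all_exists (U := fun=> shift_tournament)
  (P := fun i x => val x = shift_pair (l i) (r i))) => i.
have /andP[lr rN] := lrN i.
have p_in : shift_pair (l i) (r i) \in shift_pairs.
  by apply/shift_pairsP; exists (l i), (r i).
by exists [` p_in]%fset.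
Qed.

Lemma shift_edge_disjoint (x y : shift_tournament) (a b c d : nat) :
  val x = shift_pair a b -> val y = shift_pair c d ->
  a < b -> b < c -> c < d -> d < N -> edge x y.
Proof.
move=> Ex Ey ab bc cd dN; rewrite /edge /= /crossing_rel Ex Ey /=.
by apply/or3P; apply: Or31; apply/and3P; split; apply: slot_lt; lia.
Qed.

(** The second endpoint [c] belongs to [y], so the edge points back to the interval that starts
    first: here increasing positions give backedges. *)
Lemma shift_edge_crossing (x y : shift_tournament) (a b c d : nat) :
  val x = shift_pair a b -> val y = shift_pair c d ->
  a < c -> c < b -> b < d -> d < N -> edge y x.
Proof.
move=> Ex Ey ac cb bd dN; rewrite /edge /= /crossing_rel Ex Ey /=.
by apply/or3P; apply: Or33; apply/and3P; split; apply: slot_lt; lia.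
Qed.

End ShiftMatching.

(** * Large cliques in every numbering, and the conclusion *)

Lemma shift_clique_number (k : nat) : exists N,
  forall v : 'I_#|shift_tournament N| -> shift_tournament N,
  bijective v -> k <= clique_number v.
Proof.
have [N hN] := ramsey_pairs k.*2; exists N => v [g gK vK].
(* The value 0 is a dummy for pairs that are not vertices. *)
pose pos i j := if insub (shift_pair N i j) is Some x
                then val (g (x : shift_tournament N)) else 0.
have posE x i j : val x = shift_pair N i j -> pos i j = g x.
  by rewrite /pos => <-; rewrite valK.
have back x y : edge x y -> g y <= g x -> backedge v x y.
  move=> e le; apply/backedgeP; exists (g y), (g x); rewrite !vK.
  split=> //; last by right.
  rewrite ltn_neqAle le andbT; apply: contraTneq e.
  by move/val_inj/(can_inj vK)=> ->; rewrite edge_irr.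
have [s [sN szs hs]] := hN pos.
have s_sorted : sorted ltn s.
  exact: (@subseq_sorted _ ltn ltn_trans _ _ sN (iota_ltn_sorted 0 N)).
have s_lt i j : i < j -> j < size s -> nth 0 s i < nth 0 s j.
  move=> ij js; apply: (@sorted_ltn_nth _ ltn ltn_trans 0 s s_sorted i j) => //.
  by rewrite inE (ltn_trans ij).
have s_N i : i < size s -> nth 0 s i < N.
  by move=> /(mem_nth 0)/(mem_subseq sN); rewrite mem_iota.
case: hs => hs.
(* Consecutive entries of [s] are paired into [k] disjoint intervals. *)
- have [i|f fE] := @shift_vertices N k (fun i => nth 0 s i.*2)
    (fun i => nth 0 s i.*2.+1).
    by have ik := ltn_ord i; rewrite s_lt ?s_N //; lia.
  apply: (leq_clique_number (f := f)) => i j ij; have jk := ltn_ord j.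
  apply: back.
    by apply: (shift_edge_disjoint (fE i) (fE j)); do ?[apply: s_lt | apply: s_N]; lia.
  by rewrite -(posE _ _ _ (fE i)) -(posE _ _ _ (fE j)); apply: hs; apply: subseq_nth4; lia.
(* Pairing the entries [i] and [k + i] makes the intervals cross pairwise, as
   [i < j < k + i < k + j]. *)
- have [i|f fE] := @shift_vertices N k (fun i => nth 0 s i)
    (fun i => nth 0 s (k + i)).
    by have ik := ltn_ord i; rewrite s_lt ?s_N //; lia.
  apply: (leq_clique_number (f := f)) => i j ij; have jk := ltn_ord j.
  rewrite backedge_sym.
  apply: back.
    by apply: (shift_edge_crossing (fE i) (fE j)); do ?[apply: s_lt | apply: s_N]; lia.
  by rewrite -(posE _ _ _ (fE i)) -(posE _ _ _ (fE j)) ltnW //; apply: hs; apply: subseq_nth4; lia.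
Qed.

Theorem mainTheorem7 (k : nat) (k_ge1 : 1 <= k) :
  exists P : int_matching,
    let T := crossing_tournament P in
    (forall v : 'I_#|T| -> T, bijective v -> k <= clique_number v) /\
    k <= chromatic_number T.
Proof.
have [N hN] := shift_clique_number k; exists (shift_matching N) => /=.
split=> //; have [v [v_bij v_le]] := clique_number_chromatic (shift_tournament N).
exact: leq_trans (hN v v_bij) v_le.
Qed.
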